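(* Let $A,B,Q$ be posets and let $f:A\to Q$ and $g:B\to Q$ be order compressing maps. Suppose $f(x)=\alpha$ for some element $x$ that is maximal in $A$, and that for all $\beta\in Q$ with $\beta\neq\alpha$, $f^{-1}(\beta)=g^{-1}(\beta)$ (as subposets). If $\mathcal{G}(A)=\mathcal{G}(B)$, then $\mathcal{G}(f^{-1}(\alpha))=\mathcal{G}(g^{-1}(\alpha))$.
   Context: Poset game: played on a poset $P$ (posets are assumed such that the game is well-founded, e.g. finite); a move consists of choosing $p\in P$ and replacing $P$ by $P-p_\leq:=P\setminus\{p' : p\leq p'\}$; normal play. The nimber is defined by $\mathcal{G}(\emptyset)=0$ and $\mathcal{G}(P)=\mathrm{mex}\{\mathcal{G}(P-p_\leq):p\in P\}$, where mex is the least nonnegative integer not in the set. A function $f:P\to Q$ between posets is order compressing if for all $x,y\in P$: $f(x)=f(y)=q$ holds if and only if for every $z\in P$: (i) if $z<_P x$ and $z<_P y$ then $f(z)\leq_Q q$; (ii) if $z\not<_P x$ and $z\not<_P y$ then $f(z)\not<_Q q$; (iii) if exactly one of $z<_P x$, $z<_P y$ holds, then $f(z)=q$. For $q\in Q$, $f^{-1}(q)$ denotes the subposet of $P$ (induced order) on the preimage of $q$. *)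

(* Defs.v *)
From mathcomp Require Import all_boot all_order.
From mathcomp Require Import boolp classical_sets functions cardinality.

Set Implicit Arguments.
Unset Strict Implicit.
Unset Printing Implicit Defensive.

Import Order.TTheory.
Local Open Scope classical_set_scope.
Local Open Scope order_scope.

Definition is_mex (S : set nat) (n : nat) : Prop :=
  ~ S n /\ forall k : nat, (k < n)%N -> S k.

(* A position is a subset P of an ambient poset A, with the induced order. *)
Definition move {d : Order.disp_t} {A : porderType d} (P : set A) (p : A)
  : set A := P `\` [set p' | p <= p'].

(* The graph of the nimber function: [nimber P n] is G(P) = n. It is defined
   at P when the game on P is well founded and every position reachable from P
   has a nonnegative integer as its mex; this covers all finite posets, see
   [finite_nimber] below. The values of G outside P are irrelevant. *)
Inductive nimber {d : Order.disp_t} {A : porderType d} (P : set A) (n : nat)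
  : Prop :=
| Nimber (G : A -> nat) of
    (forall p : A, P p -> nimber (move P p) (G p)) &
    is_mex [set G p | p in P] n.

Definition same_nimber {dA dB : Order.disp_t} {A : porderType dA}
    {B : porderType dB} (P : set A) (P' : set B) : Prop :=
  exists n : nat, nimber P n /\ nimber P' n.

Definition compressing_cond {dP dQ : Order.disp_t} {P : porderType dP}
    {Q : porderType dQ} (f : P -> Q) (x y : P) (q : Q) : Prop :=
  forall z : P,
    [/\ (z < x -> z < y -> f z <= q),
        (~~ (z < x) -> ~~ (z < y) -> ~~ (f z < q)) &
        ((z < x) (+) (z < y) -> f z = q)].

(* Only the implication from "f x = f y = q" to the three conditions is
   required. With "if and only if" instead, f would have to be constant as soon
   as < is well founded on P ([order_compressing_iff_cst] below), so that not
   even the identity of a two-element poset would qualify. *)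
Definition order_compressing {dP dQ : Order.disp_t} {P : porderType dP}
    {Q : porderType dQ} (f : P -> Q) : Prop :=
  forall (x y : P) (q : Q), f x = q /\ f y = q -> compressing_cond f x y q.

Definition order_compressing_iff {dP dQ : Order.disp_t} {P : porderType dP}
    {Q : porderType dQ} (f : P -> Q) : Prop :=
  forall (x y : P) (q : Q), f x = q /\ f y = q <-> compressing_cond f x y q.

(* Identification of two subposets with different ambient types. The map is
   between the subtypes, so that two empty subposets are always isomorphic. *)
Definition order_isomorphic {dA dB : Order.disp_t} {A : porderType dA}
    {B : porderType dB} (P : set A) (P' : set B) : Prop :=
  exists phi : set_type P -> set_type P',
    bijective phi /\
    forall x y : set_type P, (val (phi x) <= val (phi y)) = (val x <= val y).

Lemma is_mex_uniq (S : set nat) (m n : nat) : is_mex S m -> is_mex S n -> m = n.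
Proof.
move=> [Sm mS] [Sn nS].
by have [/nS//|/mS//|] := ltngtP m n.
Qed.

Lemma nimber_uniq (d : Order.disp_t) (A : porderType d) (P : set A)
  (m n : nat) : nimber P m -> nimber P n -> m = n.
Proof.
move=> Pm; elim: Pm n => {P m} P m G _ IH mexm n [G' G'P mexn].
apply: (is_mex_uniq mexm); congr is_mex: mexn.
apply/seteqP; split=> k [p Pp <-]; exists p => //.
  by apply: IH => //; exact: G'P.
by apply/esym/IH => //; exact: G'P.
Qed.

Lemma nimber_set0 (d : Order.disp_t) (A : porderType d) :
  nimber (@set0 A) 0.
Proof. by exists (fun=> 0%N) => //; split=> // -[p []]. Qed.

Lemma finite_nimber (d : Order.disp_t) (A : porderType d) (P : set A) :
  finite_set P -> exists n, nimber P n.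
Proof.
move=> /finite_seqP[s ->] {P}.
have [N] := ubnP (size s); elim: N s => // N IH s sN.
have [G GP] : exists G : A -> nat,
    forall p, [set` s] p -> nimber (move [set` s] p) (G p).
  suff /boolp.choice[G GP] : forall p, exists k,
      [set` s] p -> nimber (move [set` s] p) k by exists G.
  move=> p; have [ps|/negP ps] := boolP (p \in s); last by exists 0%N.
  have -> : move [set` s] p = [set` [seq x <- s | ~~ (p <= x)]].
    apply/seteqP; split=> x /=; rewrite mem_filter.
      by move=> [xs /negP px]; rewrite px.
    by move=> /andP[/negP px xs].
  have [|k nk] := IH [seq x <- s | ~~ (p <= x)]; last by exists k.
  rewrite -ltnS (leq_trans _ sN) // ltnS size_filter.
  rewrite ltn_neqAle count_size andbT -all_count.
  by apply/allPn; exists p => //; rewrite lexx.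
pose t := map G s.
have tE : [set G p | p in [set` s]] = [set` t].
  apply/seteqP; split=> k /=; first by move=> [p ps <-]; exact: map_f.
  by move=> /mapP[p ps ->]; exists p.
have exk : exists k, k \notin t.
  exists (\max_(i <- t) i).+1; apply/negP => ti.
  by have := @leq_bigmax_seq _ t predT id _ ti isT; rewrite ltnn.
have [n nt nmin] := ex_minnP exk; exists n; exists G => //; rewrite tE.
split=> /=; first exact/negP.
by move=> k kn; apply: contraLR kn => /nmin; rewrite -leqNgt.
Qed.

Lemma order_compressing_iffW (dP dQ : Order.disp_t) (P : porderType dP)
    (Q : porderType dQ) (f : P -> Q) :
  order_compressing_iff f -> order_compressing f.
Proof. by move=> fP x y q /fP. Qed.

Lemma order_compressing_iff_cst (dP dQ : Order.disp_t) (P : porderType dP)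
    (Q : porderType dQ) (f : P -> Q) :
  well_founded (fun x y : P => x < y) -> order_compressing_iff f ->
  forall x y : P, f x = f y.
Proof.
move=> wf fP.
have flt z x : f z < f x -> z < x.
  have [_ + _] := (fP x x (f x)).1 (conj erefl erefl) z.
  by case: (z < x) => // /(_ isT isT)/negbTE ->.
have cst m y : (forall z, ~~ (z < m)) -> f y = f m.
  move=> mmin; elim/(well_founded_ind wf): y => y IH.
  suff /fP[] : compressing_cond f m y (f m) by [].
  move=> z; rewrite (negbTE (mmin z)); split=> //=; last exact: IH.
  by move=> _ _; apply: contra (mmin z); exact: flt.
move=> x y; suff [m mmin] : exists m : P, forall z, ~~ (z < m).
  by rewrite (cst m x) // (cst m y).
elim/(well_founded_ind wf): x => x IH.
have [[z /IH//]|nx] := pselect (exists z, z < x).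
by exists x => z; apply/negP => zx; apply: nx; exists z.
Qed.

(* Main.v *)
(* A compressing map f makes A the ordinal sum over Q of its fibres: points in
   different fibres are ordered like their images.  Hence the fibre U over alpha
   is an up-set of A, and any other point lies below all of U or below none of
   it; the same holds for the fibre V of B.  Let P and P' be positions of A and B
   that agree outside U and V.  Then G(P) = G(P') iff G(P n U) = G(P' n V), by
   simultaneous induction: a move in U changes only the value of P n U, a move
   outside can be copied and either erases U and V or leaves them alone.
   The nimber of P n U must moreover be shown to be a natural number.  Playing
   away the points incomparable to U, we may assume that the others lie below
   U.  If the options of P n U took all natural values, then, by injectivity,
   some option of P with a move in U would have a value above G(P), hence would
   itself have an option of value G(P), which is also the value of an option of
   P. *)
Require Import Defs.
From mathcomp Require Import all_boot all_order.
From mathcomp Require Import boolp classical_sets functions cardinality.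

Set Implicit Arguments.
Unset Strict Implicit.
Unset Printing Implicit Defensive.

Import Order.TTheory.
Local Open Scope classical_set_scope.
Local Open Scope order_scope.

Lemma is_mex_exists (S : set nat) : (exists k, ~ S k) -> exists n, is_mex S n.
Proof.
move=> [k /asboolPn Sk].
have exS : exists k, ~~ `[< S k >] by exists k.
have [n /asboolPn Sn nmin] := ex_minnP exS.
exists n; split=> // j jn; apply: contrapT => /asboolPn /nmin.
by rewrite leqNgt jn.
Qed.

(** * Moves and their effect on the part of a position inside U *)

Section Moves.
Context {d : Order.disp_t} {A : porderType d}.
Implicit Types (P U : set A) (p : A).

Lemma nimber_move P m p : nimber P m -> P p ->
  exists2 k, nimber (move P p) k & k <> m.
Proof.
move=> [G GP [mG _]] Pp; exists (G p); first exact: GP.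
by move=> Gpm; apply: mG; exists p.
Qed.

Lemma nimber_option P m k : nimber P m -> (k < m)%N ->
  exists2 p, P p & nimber (move P p) k.
Proof. by move=> [G GP [_ Gm]] /Gm[p Pp <-]; exists p => //; exact: GP. Qed.

Lemma moveIl P U p : move (P `&` U) p = (move P p `&` U)%classic.
Proof. by apply/seteqP; split=> x /= [[]]. Qed.

Lemma moveI_below P U p : (forall u, U u -> p <= u) ->
  (move P p `&` U)%classic = set0.
Proof. by move=> pU; apply/seteqP; split=> // x [[_ +] /pU]. Qed.

Lemma moveI_notbelow P U p : (forall u, U u -> (p <= u) = false) ->
  (move P p `&` U = P `&` U)%classic.
Proof.
move=> pU; apply/seteqP; split=> x; first by move=> [[]].
by move=> [Px Ux]; split=> //; split=> //=; rewrite pU.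
Qed.

End Moves.

(* M is the graph of an isomorphism between the complements of U and V. *)
Record matching {dA dB : Order.disp_t} {A : porderType dA} {B : porderType dB}
    (M : A -> B -> Prop) (U : set A) (V : set B) : Prop := Matching {
  matching_outside : forall a b, M a b -> ~ U a /\ ~ V b;
  matching_le : forall a b a' b', M a b -> M a' b' -> (a <= a') = (b <= b');
  matching_totall : forall a, ~ U a -> exists b, M a b;
  matching_totalr : forall b, ~ V b -> exists a, M a b;
  matching_below : forall a b, M a b -> exists c : bool,
    (forall u, U u -> (a <= u) = c) /\ (forall v, V v -> (b <= v) = c);
  matching_upl : forall u a, U u -> u <= a -> U a;
  matching_upr : forall v b, V v -> v <= b -> V b }.

Definition agree {A B : Type} (M : A -> B -> Prop) (P : set A) (P' : set B) :=
  forall a b, M a b -> (P a <-> P' b).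

(** Agreement is a premise inside the property, so inductions on positions need not carry it. All
    four values are assumed, since P n U is not yet known to have a nimber. *)
Definition nimber_reflecting {dA dB : Order.disp_t} {A : porderType dA}
    {B : porderType dB} (M : A -> B -> Prop) (U : set A) (V : set B)
    (P : set A) (P' : set B) : Prop :=
  agree M P P' -> forall m m' s t, nimber P m -> nimber P' m' ->
    nimber (P `&` U) s -> nimber (P' `&` V) t -> (m = m' <-> s = t).

Lemma agree_sym {A B : Type} (M : A -> B -> Prop) P P' :
  agree M P P' -> agree (fun b a => M a b) P' P.
Proof. by move=> PP' b a /PP'[]. Qed.

Section MatchingSym.
Context {dA dB : Order.disp_t} {A : porderType dA} {B : porderType dB}.
Variables (M : A -> B -> Prop) (U : set A) (V : set B).

Lemma matching_sym : matching M U V -> matching (fun b a => M a b) V U.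
Proof.
case=> out le tl tr be ul ur; split=> //.
- by move=> b a /out[].
- by move=> b a b' a' ab ab'; rewrite (le a b a' b').
- by move=> b a /be[c []]; exists c.
Qed.

Lemma nimber_reflecting_sym P P' : nimber_reflecting M U V P P' ->
  nimber_reflecting (fun b a => M a b) V U P' P.
Proof.
move=> H P'P m m' s t Pm Pm' Ps Pt.
by have [h1 h2] := H (agree_sym P'P) _ _ _ _ Pm' Pm Pt Ps; split=> /esym => [/h1|/h2].
Qed.

(** Allows two positions of the same poset to be compared. *)
Lemma matching_self : matching M U V -> matching (fun a b => a = b /\ ~ U a) U U.
Proof.
case=> out le tl tr be ul ur; split=> //.
- by move=> a _ [<-].
- by move=> a _ a' _ [<- _] [<- _].
- by move=> a Ua; exists a.
- by move=> a Ua; exists a.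
- by move=> a _ [<- /tl[b /be[c [cU _]]]]; exists c.
Qed.

End MatchingSym.

(** * Equality of nimbers is reflected by the parts in U and V *)

Section ReflectingStep.
Context {dA dB : Order.disp_t} {A : porderType dA} {B : porderType dB}.
Variables (M : A -> B -> Prop) (U : set A) (V : set B).
Hypothesis MUV : matching M U V.

Lemma agree_movel (P : set A) (P' : set B) p : U p -> agree M P P' -> agree M (move P p) P'.
Proof.
move=> Up PP' a b ab; rewrite -(PP' a b ab); split=> [[]//|Pa].
split=> //= pa; have [Ua _] := matching_outside MUV ab.
exact/Ua/(matching_upl MUV Up).
Qed.

Lemma agree_move2 (P : set A) (P' : set B) p q : M p q -> agree M P P' ->
  agree M (move P p) (move P' q).
Proof.
by move=> pq PP' a b ab; rewrite /move /= (PP' a b ab) (matching_le MUV pq ab).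
Qed.

Lemma reflecting_step_eq (P : set A) (P' : set B) m m' s :
  (forall p, P p -> nimber_reflecting M U V (move P p) P') ->
  (forall p q, P p -> P' q -> nimber_reflecting M U V (move P p) (move P' q)) ->
  agree M P P' -> nimber P m -> nimber P' m' ->
  nimber (P `&` U) s -> nimber (P' `&` V) s -> (m <= m')%N.
Proof.
move=> IHl IH2 PP' Pm Pm' Ps Ps'; rewrite leqNgt; apply/negP => m'm.
have [p Pp pm'] := nimber_option Pm m'm.
have [Up|Up] := pselect (U p).
  have [s' + s's] := nimber_move Ps (conj Pp Up).
  rewrite moveIl => ps'; apply: s's.
  by apply/(IHl p Pp (agree_movel Up PP') _ _ _ _ pm' Pm' ps' Ps').
have [q pq] := matching_totall MUV Up.
have P'q : P' q by apply/(PP' p q pq).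
have [k qk km'] := nimber_move Pm' P'q; apply/km'/esym.
have {}IH2 := IH2 p q Pp P'q (agree_move2 pq PP') _ _ _ _ pm' qk.
(* After the copied move both parts are empty, of value 0, or both are unchanged, of value [s]. *)
have [[] [pU qV]] := matching_below MUV pq.
  by apply/(IH2 0 0)%N; rewrite ?(moveI_below _ pU) ?(moveI_below _ qV) //;
    exact: nimber_set0.
by apply/(IH2 s s); rewrite ?(moveI_notbelow _ pU) ?(moveI_notbelow _ qV).
Qed.

(** Some move in U lowers [s] to [t]; the resulting option of P has the value of P', which therefore
    cannot be that of P. *)
Lemma reflecting_step_lt (P : set A) (P' : set B) m m' s t :
  (forall p, P p -> nimber_reflecting M U V (move P p) P') ->
  agree M P P' -> nimber P m -> nimber P' m' ->
  nimber (P `&` U) s -> nimber (P' `&` V) t -> (t < s)%N -> m <> m'.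
Proof.
move=> IHl PP' Pm Pm' Ps Pt ts.
have [p [Pp Up]] := nimber_option Ps ts; rewrite moveIl => pt.
have [k pk km] := nimber_move Pm Pp => mm'; apply: km; rewrite mm'.
by apply/(IHl p Pp (agree_movel Up PP') _ _ _ _ pk Pm' pt Pt).
Qed.

End ReflectingStep.

Section Reflecting.
Context {dA dB : Order.disp_t} {A : porderType dA} {B : porderType dB}.
Variables (M : A -> B -> Prop) (U : set A) (V : set B).
Hypothesis MUV : matching M U V.

Lemma nimber_reflectingP (P : set A) (P' : set B) m m' :
  nimber P m -> nimber P' m' -> nimber_reflecting M U V P P'.
Proof.
move=> Pm; elim: Pm P' m' => {P m} P _ G _ IHP _ P' m' Pm'.
(* The outer induction covers a move in P against any position, in particular P' and its options;
   the inner one covers moves in P' alone. *)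
have IHPl P1 m1 : nimber P1 m1 ->
    forall p, P p -> nimber_reflecting M U V (move P p) P1.
  by move=> P1m1 p Pp; exact: IHP P1m1.
elim: Pm' => {P' m'} P' m' G' GP' IHP' mexm'.
have Pm' : nimber P' m' by exists G'.
have IHl := IHPl _ _ Pm'.
have IH2 p q (Pp : P p) (P'q : P' q) := IHPl _ _ (GP' q P'q) p Pp.
move=> PP' {mexm'}m {Pm'}m' s t Pm Pm' Ps Pt.
have MUV' := matching_sym MUV.
have IHr q (P'q : P' q) := nimber_reflecting_sym (IHP' q P'q).
have IH2' q p (P'q : P' q) (Pp : P p) := nimber_reflecting_sym (IH2 p q Pp P'q).
have P'P := agree_sym PP'.
split=> [mm'|st].
  have [st|ts|//] := ltngtP s t.
    by have := reflecting_step_lt MUV' IHr P'P Pm' Pm Pt Ps st; rewrite mm'.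
  by have := reflecting_step_lt MUV IHl PP' Pm Pm' Ps Pt ts; rewrite mm'.
rewrite -{t}st in Pt; apply/eqP; rewrite eqn_leq.
rewrite (reflecting_step_eq MUV IHl IH2 PP' Pm Pm' Ps Pt).
by rewrite (reflecting_step_eq MUV' IHr IH2' P'P Pm' Pm Pt Ps).
Qed.

End Reflecting.

(** * Existence of the nimber of P n U *)

Lemma injective_nat_large (h : nat -> nat) k :
  injective h -> (forall i, h i <> k) -> exists i, (k < h i)%N.
Proof.
move=> inj hk; apply: contrapT => hle.
have lt i : (h i < k)%N.
  rewrite ltn_neqAle; apply/andP; split; first exact/eqP.
  by rewrite leqNgt; apply/negP => ki; apply: hle; exists i.
(* Pigeonhole: k+1 indices would inject into k values. *)
have := @leq_card _ _ (fun i : 'I_k.+1 => Ordinal (lt i)) _.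
rewrite !card_ord ltnn => H; apply/notF/H => i j [/inj ij].
exact/val_inj.
Qed.

Lemma nimber_top_exists (dA dB : Order.disp_t) (A : porderType dA)
    (B : porderType dB) (M : A -> B -> Prop) (U : set A) (V : set B)
    (P : set A) m :
  matching M U V -> nimber P m -> exists s, nimber (P `&` U) s.
Proof.
move=> /matching_self; set E := (fun a b => _) => EUU.
elim=> {P m} P m G GP IH mexm.
have Pm : nimber P m by exists G.
have [[a [Pa aU]]|Pbelow] :=
    pselect (exists a, P a /\ forall u, U u -> (a <= u) = false).
  by have := IH a Pa; rewrite (moveI_notbelow _ aU).
have below a : P a -> ~ U a -> forall u, U u -> a <= u.
  move=> Pa Ua; have [[] [aU _]] := matching_below EUU (conj (erefl a) Ua) => //.
  by case: Pbelow; exists a.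
have /boolp.choice[s sP] : forall p, exists k,
    (P `&` U) p -> nimber (move (P `&` U) p) k.
  move=> p; have [[Pp Up]|nPU] := pselect ((P `&` U) p); last by exists 0%N.
  by have [k pk] := IH p Pp; exists k => _; rewrite moveIl.
suff [n mexn] : exists n, is_mex [set s p | p in P `&` U] n.
  by exists n; exists s.
apply: is_mex_exists; apply: contrapT => full.
have /boolp.choice[p pP] : forall i, exists p, (P `&` U) p /\ s p = i.
  move=> i; have [[p PUp <-]|ni] := pselect ([set s p | p in P `&` U] i).
    by exists p.
  by case: full; exists i.
have pU i : U (p i) by have [[]] := pP i.
have Pp i : P (p i) by have [[]] := pP i.
have sp i : nimber (move P (p i) `&` U) i.
  by have [/sP + si] := pP i; rewrite moveIl si.
have agreeE P1 : agree E P1 P1 by move=> a _ [<-].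
have agree2 i P1 : agree E P1 P -> agree E P1 (move P (p i)).
  move=> P1P.
  exact: agree_sym (agree_movel (matching_sym EUU) (pU i) (agree_sym P1P)).
(* [move P (p i)] is the reference position whose part in U has value [i]. *)
have reflect i P1 k t : agree E P1 P -> nimber P1 k -> nimber (P1 `&` U) t ->
    k = G (p i) <-> t = i.
  move=> P1P P1k P1t.
  exact: (nimber_reflectingP EUU P1k (GP _ (Pp i)) (agree2 i _ P1P)
    P1k (GP _ (Pp i)) P1t (sp i)).
have Gm i : G (p i) <> m.
  by case: mexm => mG _ Gim; apply: mG; exists (p i).
have agreeP i : agree E (move P (p i)) P := agree_movel EUU (pU i) (agreeE P).
have Ginj : injective (G \o p).
  by move=> i j /= /(reflect j _ _ _ (agreeP i) (GP _ (Pp i)) (sp i)).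
have [i mi] := injective_nat_large Ginj Gm.
have [q [Pq piq] qm] := nimber_option (GP _ (Pp i)) mi.
(* If [q] is in U and leaves a part of value [j], then [move P (p j)] also has value [m], impossible
   for an option of P. *)
have [Uq|Uq] := pselect (U q).
  have [j + _] := nimber_move (sp i) (conj (conj Pq piq) Uq).
  rewrite moveIl => qj; apply: (Gm j); apply/esym.
  by apply/(reflect j _ _ _ (agree_movel EUU Uq (agreeP i)) qm qj).
(* Here [q] lies below [p i], so playing it makes the earlier move at [p i] irrelevant. *)
have moveE : move (move P (p i)) q = move P q.
  apply/seteqP; split=> x /=; first by move=> [[]].
  move=> [Px qx]; split=> //; split=> //= pix; apply: qx.
  exact: le_trans (below q Pq Uq _ (pU i)) pix.
rewrite moveE in qm.
by have [k qk] := nimber_move Pm Pq; apply; exact: nimber_uniq qk qm.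
Qed.

(** * From compressing maps to a matching *)

Lemma order_compressing_le (dP dQ : Order.disp_t) (P : porderType dP)
    (Q : porderType dQ) (f : P -> Q) :
  order_compressing f ->
  forall x y, f x <> f y -> (x <= y) = (f x <= f y).
Proof.
(* The condition is taken at the pair (y, y), with [x] as the test point. *)
move=> fP x y fxy; have [lef ltf _] := fP y y _ (conj erefl erefl) x.
apply/idP/idP => [|fle].
  by rewrite le_eqVlt => /predU1P[xy|xy]; [rewrite xy in fxy|exact: lef].
apply/ltW/contraT => nxy; have /negP[] := ltf nxy nxy.
by rewrite lt_neqAle fle andbT; exact/eqP.
Qed.

Lemma compressing_matching (dA dB dQ : Order.disp_t)
    (A : porderType dA) (B : porderType dB) (Q : porderType dQ)
    (f : A -> Q) (g : B -> Q) (alpha : Q) :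
  order_compressing f -> order_compressing g ->
  (exists x : A, (forall y : A, x <= y -> y = x) /\ f x = alpha) ->
  (forall beta : Q, beta <> alpha ->
     order_isomorphic (f @^-1` [set beta]) (g @^-1` [set beta])) ->
  exists M, matching M (f @^-1` [set alpha]) (g @^-1` [set alpha]).
Proof.
move=> hf hg [x [xmax fx]] hfib.
have [leA leB] := (order_compressing_le hf, order_compressing_le hg).
pose phi beta (h : beta <> alpha) := sval (cid (hfib beta h)).
have phi_bij beta h : bijective (@phi beta h).
  by rewrite /phi; case: cid => ? [].
have phi_le beta h u v : (val (@phi beta h u) <= val (@phi beta h v))
    = (val u <= val v).
  by rewrite /phi; case: cid => ? [].
pose M a b := exists beta (h : beta <> alpha) (u : set_type (f @^-1` [set beta])),
  a = val u /\ b = val (@phi beta h u).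
have fval beta (u : set_type (f @^-1` [set beta])) : f (val u) = beta.
  exact: set_valP u.
have gval beta (u : set_type (g @^-1` [set beta])) : g (val u) = beta.
  exact: set_valP u.
have Mfib a b : M a b -> f a <> alpha /\ g b = f a.
  by move=> [beta [h [u [-> ->]]]]; rewrite fval gval.
have Mtotl a : f a <> alpha -> exists b, M a b.
  move=> h; have fa : a \in f @^-1` [set f a] by rewrite inE.
  by exists (val (phi _ h (SigSub fa))), (f a), h, (SigSub fa).
have Mtotr b : g b <> alpha -> exists a, M a b.
  move=> h; have gb : b \in g @^-1` [set g b] by rewrite inE.
  have [psi _ phiK] := phi_bij _ h.
  by exists (val (psi (SigSub gb))), (g b), h, (psi (SigSub gb)); rewrite phiK.
(* Otherwise alpha lies below [f a], which puts [a] above the maximal point [x]. *)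
have fup u a : f u = alpha -> u <= a -> f a = alpha.
  move=> fu ua; apply: contrapT => fa.
  have xa : x <= a.
    rewrite leA // ?fx; last exact/nesym.
    by rewrite -fu -leA // fu; exact/nesym.
  by apply: fa; rewrite (xmax a xa).
exists M; split => //.
- by move=> a b /Mfib[fa gb] /=; rewrite gb.
- move=> a b a' b' ab ab'.
  have [[_ gb] [_ gb']] := (Mfib _ _ ab, Mfib _ _ ab').
  have [faa'|faa'] := pselect (f a = f a'); last first.
    by rewrite leA // leB gb gb'.
  move: ab ab' faa' => [beta [h [u [-> ->]]]] [beta' [h' [u' [-> ->]]]].
  rewrite !fval => e; subst beta'.
  (* Identifying the two proofs that beta differs from alpha makes both points pass through the same
     isomorphism. *)
  by rewrite (Prop_irrelevance h' h) phi_le.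
- move=> a b /Mfib[fa gb]; exists (f a <= alpha); split=> [u fu|v gv].
    by rewrite leA fu.
  by rewrite leB gv gb.
(* No maximal point is given in B, so [b] is carried back to a point of A above [x]. *)
- move=> v b gv vb; apply: contrapT => gb.
  have [a /Mfib[fa gbE]] := Mtotr b gb.
  apply: fa; apply: (fup x) => //.
  have fxa : f x <> f a by rewrite fx -gbE; exact/nesym.
  by rewrite leA // fx -gbE -gv -leB // gv; exact/nesym.
Qed.

Theorem theorem3 (dA dB dQ : Order.disp_t)
    (A : porderType dA) (B : porderType dB) (Q : porderType dQ)
    (f : A -> Q) (g : B -> Q) (alpha : Q)
    (hf : order_compressing f) (hg : order_compressing g)
    (hmax : exists x : A, (forall y : A, x <= y -> y = x) /\ f x = alpha)
    (hfib : forall beta : Q, beta <> alpha ->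
       order_isomorphic (f @^-1` [set beta]) (g @^-1` [set beta]))
    (hG : same_nimber [set: A] [set: B]) :
  same_nimber (f @^-1` [set alpha]) (g @^-1` [set alpha]).
Proof.
have [M MUV] := compressing_matching hf hg hmax hfib.
have [n [An Bn]] := hG.
have [s Us] := nimber_top_exists MUV An.
have [t Vt] := nimber_top_exists (matching_sym MUV) Bn.
have TT : agree M [set: A] [set: B] by [].
have st : s = t.
  by apply/(nimber_reflectingP MUV An Bn TT An Bn Us Vt).
by exists s; split; [move: Us|move: Vt; rewrite -st]; rewrite setTI.
Qed.
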